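(* The Riordan group $\mathcal{R}(\mathbb{F})$ can be partitioned into matrices with three different types of sets of eigenvectors: $$\mathcal{R}(\mathbb{F})=\mathcal{R}_{\rm full}\ \sqcup\ \bigsqcup_{k=0}^{\infty}\mathcal{R}_k\ \sqcup\ \mathcal{R}_{\rm none}.$$
   Context: $\mathbb{F}$ is the field of real or complex numbers. For formal power series $g,F\in\mathbb{F}[[x]]$ with $g(0)\neq0$, $F(0)=0$, $F'(0)\ne0$, the Riordan matrix $(g,F)$ is the infinite lower triangular matrix $[a_{ij}]_{i,j\ge0}$ with $a_{ij}=[x^i]\,g(x)F(x)^j$. The Riordan group $\mathcal{R}(\mathbb{F})$ is the group of all Riordan matrices over $\mathbb{F}$ under matrix multiplication. An eigenvector of $A\in\mathcal{R}(\mathbb{F})$ is a nonzero vector ${\bf h}\in\mathbb{F}^{\mathbb{N}_0}$ (infinite column) with $A{\bf h}=\lambda{\bf h}$ for some $\lambda\in\mathbb{F}$. An eigenvector has level $k$ if it has the form $(0,\ldots,0,h_k,h_{k+1},\ldots)^T$ with $h_k\neq0$. A full set of eigenvectors is a set $\{{\bf h}_0,{\bf h}_1,\ldots\}$ of eigenvectors with ${\bf h}_k$ of level $k$ for every $k\ge0$. $\mathcal{R}_{\rm full}$ is the set of Riordan matrices having a full set of eigenvectors; $\mathcal{R}_{\rm none}$ is the set of Riordan matrices having no eigenvectors; for $k\ge0$, $\mathcal{R}_k$ is the set of Riordan matrices with a one-dimensional set of eigenvectors, all of level $k$ (i.e. the eigenvectors are exactly the nonzero scalar multiples of a single vector of level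 $k$). *)

(* Defs.v *)
From HB Require Import structures.
From mathcomp Require Import all_boot all_order all_algebra.
From mathcomp Require Import all_classical all_reals.

Set Implicit Arguments.
Unset Strict Implicit.
Unset Printing Implicit Defensive.

Import GRing.Theory.

Local Open Scope classical_set_scope.
Local Open Scope ring_scope.

Section Riordan.
Variable K : fieldType.

(* The power series \sum_n f_n x^n is represented by n |-> f_n. *)
Definition series := nat -> K.
Definition vec := nat -> K.
Definition infmx := nat -> nat -> K.

Definition series_one : series := fun n => (n == 0%N)%:R.

Definition series_mul (f g : series) : series :=
  fun n => \sum_(i < n.+1) f i * g (n - i)%N.

Definition series_exp (f : series) (j : nat) : series :=
  iter j (series_mul f) series_one.

Definition riordan_mx (g f : series) : infmx :=
  fun i j => series_mul g (series_exp f j) i.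

(* f 1 is the value of f' at 0. *)
Definition riordan_group : set infmx :=
  [set A | exists g f : series,
     [/\ g 0%N != 0, f 0%N = 0, f 1%N != 0 & A = riordan_mx g f]].

(* The sum ranges over the j with A i j * h j != 0, of which there are only
   finitely many when A is lower triangular. *)
Definition mulmxvec (A : infmx) (h : vec) : vec :=
  fun i => \sum_(j \in [set: nat]) A i j * h j.

Definition eigenvector (A : infmx) (h : vec) : Prop :=
  h <> (fun=> 0) /\ exists lambda : K, mulmxvec A h = (fun i => lambda * h i).

Definition has_level (k : nat) (h : vec) : Prop :=
  (forall i, (i < k)%N -> h i = 0) /\ h k != 0.

Definition riordan_full : set infmx :=
  [set A | riordan_group A /\
     exists h : nat -> vec, forall k, eigenvector A (h k) /\ has_level k (h k)].

Definition riordan_level (k : nat) : set infmx :=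
  [set A | riordan_group A /\
     exists2 h : vec, has_level k h &
       eigenvector A = [set v | exists2 c : K, c != 0 & v = (fun i => c * h i)]].

Definition riordan_none : set infmx :=
  [set A | riordan_group A /\ forall h, ~ eigenvector A h].

End Riordan.

Arguments riordan_group K : clear implicits.
Arguments riordan_full K : clear implicits.
Arguments riordan_level K k : clear implicits.
Arguments riordan_none K : clear implicits.

Inductive eigentype := EigenFull | EigenLevel of nat | EigenNone.

Definition eigenclass (K : fieldType) (t : eigentype) : set (infmx K) :=
  match t with
  | EigenFull => riordan_full K
  | EigenLevel k => riordan_level K k
  | EigenNone => riordan_none K
  end.

Arguments eigenclass K t : clear implicits.

(* Main.v *)
Require Import Defs.
From HB Require Import structures.
From mathcomp Require Import all_boot all_order all_algebra.
From mathcomp Require Import all_classical all_reals.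
From mathcomp Require Import complex.
From mathcomp Require Import ring zify.

Set Implicit Arguments.
Unset Strict Implicit.
Unset Printing Implicit Defensive.

Import GRing.Theory Num.Theory.

(** Identify a vector [h] with the power series [\sum_n h_n x^n]. The Riordan
matrix [(g, F)] then sends [h] to [g h(F)], so that an eigenvector is a nonzero
solution of [g h(F) = lambda h]. Write [F = x phi]; if [h] has level [k],
comparing coefficients of [x^k] gives [lambda = g(0) phi(0)^k]
([eigenvalue_level]).

The heart of the argument is that two eigenvectors [h], [h'] of different levels
[k < l] force a full set of eigenvectors. Since composition with [F] is a ring
morphism, the quotient [q = h' / h] satisfies [q(F) = phi(0)^m q] where
[m = l - k] is its order. In characteristic zero [q = c p^m] for a constant [c]
and a series [p = x w] with [w(0) = 1] ([fps_root]). Then [p(F)] and [phi(0) p]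
have the same [m]-th power and the same leading coefficient, so they are equal
([fps_expr_inj]): [p] linearizes [F]. Put [e = h / p^k]; then
[g e(F) = g(0) e], and the series [p^j e] are eigenvectors of every level [j]
([linearized_of_eigen2], [riordan_full_of_linearized]).

Two eigenvectors of the same level have the same eigenvalue, so if they are not
proportional some combination of them is an eigenvector of higher level
([eigenvector_same_level]). Hence, as soon as there is an eigenvector, either all
of them are proportional to it or there is a full set
([riordan_level_or_full]).

None of the classes is empty. The identity has a full set. When
[g(0) = phi(0) = 1], an eigenvector of level [l] satisfies
[g_1 + l phi_1 = 0] ([eigenvector_unipotent_level]). Therefore [(1 + x, x)] has
no eigenvector, and the eigenvectors of [((1 - x)^k, x / (1 - x))], among which
[x^k], all have level [k]. *)

(** * Formal power series over a field *)

Section PowerSeriesRing.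
Local Open Scope ring_scope.
Variable K : fieldType.

(** Formal power series. Wrapping coefficient sequences in a record keeps the
Cauchy product apart from the pointwise product of functions. *)
Record fps := Fps { fps_coef :> nat -> K }.

HB.instance Definition _ := [isNew for fps_coef].
HB.instance Definition _ := [Choice of fps by <:].

Implicit Types f g h : fps.

Lemma fpsP f g : f =1 g -> f = g.
Proof. by case: f g => [f] [g] /= /funext ->. Qed.

Definition fps_zero := Fps (fun=> 0).
Definition fps_opp f := Fps (fun n => - f n).
Definition fps_add f g := Fps (fun n => f n + g n).

Fact fps_addA : associative fps_add.
Proof. by move=> f g h; apply: fpsP => n /=; rewrite addrA. Qed.
Fact fps_addC : commutative fps_add.
Proof. by move=> f g; apply: fpsP => n /=; rewrite addrC. Qed.
Fact fps_add0 : left_id fps_zero fps_add.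
Proof. by move=> f; apply: fpsP => n /=; rewrite add0r. Qed.
Fact fps_addN : left_inverse fps_zero fps_opp fps_add.
Proof. by move=> f; apply: fpsP => n /=; rewrite addNr. Qed.

HB.instance Definition _ :=
  GRing.isZmodule.Build fps fps_addA fps_addC fps_add0 fps_addN.

Definition fps_one := Fps (series_one K).
Definition fps_mul f g := Fps (series_mul f g).

(** The polynomial of degree less than [N] that agrees with [f] modulo [x^N]. *)
Definition fps_trunc N f : {poly K} := \poly_(i < N) f i.

Lemma coef_trunc N f i : (i < N)%N -> (fps_trunc N f)`_i = f i.
Proof. by move=> iN; rewrite coef_poly iN. Qed.

(** Associativity and commutativity thus follow from those of polynomials. *)
Lemma fps_mul_trunc N f g n : (n < N)%N ->
  fps_mul f g n = (fps_trunc N f * fps_trunc N g)`_n.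
Proof.
move=> nN; rewrite coefM; apply: eq_bigr => i _.
by rewrite !coef_trunc//; have := ltn_ord i; lia.
Qed.

Fact fps_mulC : commutative fps_mul.
Proof.
move=> f g; apply: fpsP => n.
by rewrite !(@fps_mul_trunc n.+1)// mulrC.
Qed.

Fact fps_mulA : associative fps_mul.
Proof.
move=> f g h; apply: fpsP => n; pose t := fps_trunc n.+1.
transitivity (t f * (t g * t h))`_n.
  rewrite coefM; apply: eq_bigr => i _.
  by rewrite coef_trunc// -(@fps_mul_trunc n.+1)// ltnS leq_subr.
rewrite mulrA coefM; apply: eq_bigr => i _.
by rewrite coef_trunc ?ltnS ?leq_subr// -(@fps_mul_trunc n.+1).
Qed.

Fact fps_mul1 : left_id fps_one fps_mul.
Proof.
move=> f; apply: fpsP => n /=; rewrite /series_mul big_ord_recl /= subn0.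
rewrite /series_one eqxx mul1r big1 ?addr0// => i _.
by rewrite mul0r.
Qed.

Fact fps_mulDl : left_distributive fps_mul fps_add.
Proof.
move=> f g h; apply: fpsP => n /=; rewrite -big_split.
by apply: eq_bigr => i _; rewrite mulrDl.
Qed.

Fact fps_one_neq0 : fps_one != 0.
Proof.
apply/eqP => /(congr1 (fun f : fps => f 0%N)) /=.
by rewrite /series_one eqxx => /eqP; rewrite oner_eq0.
Qed.

HB.instance Definition _ := GRing.Zmodule_isComNzRing.Build fps
  fps_mulA fps_mulC fps_mul1 fps_mulDl fps_one_neq0.

Lemma coef_fpsD f g n : (f + g) n = f n + g n. Proof. by []. Qed.
Lemma coef_fpsB f g n : (f - g) n = f n - g n. Proof. by []. Qed.
Lemma coef_fps1 n : (1 : fps) n = (n == 0%N)%:R. Proof. by []. Qed.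
Lemma coef_fpsM f g n : (f * g) n = \sum_(i < n.+1) f i * g (n - i)%N.
Proof. by []. Qed.

Lemma coef_fps_sum I (r : seq I) (P : pred I) (F : I -> fps) n :
  (\sum_(i <- r | P i) F i) n = \sum_(i <- r | P i) F i n.
Proof. by elim/big_rec2: _ => // i x y _ <-. Qed.

Lemma coef_fpsM0 f g : (f * g) 0%N = f 0%N * g 0%N.
Proof. by rewrite coef_fpsM big_ord1. Qed.

Lemma coef_fpsM1 f g : (f * g) 1%N = f 0%N * g 1%N + f 1%N * g 0%N.
Proof. by rewrite coef_fpsM !big_ord_recl big_ord0 addr0. Qed.

Lemma coef_fpsX0 f m : (f ^+ m) 0%N = f 0%N ^+ m.
Proof. by elim: m => // m IH; rewrite !exprS coef_fpsM0 IH. Qed.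

(** Linear coefficient of a power, for a constant term equal to [1]. *)
Lemma coef_fpsX1 f m : f 0%N = 1 -> (f ^+ m) 1%N = f 1%N *+ m.
Proof.
move=> f0; elim: m => // m IH.
by rewrite exprS coef_fpsM1 IH coef_fpsX0 f0 expr1n mul1r mulr1 mulrSr.
Qed.

(** Constant series. *)
Definition fpsC (c : K) := Fps (fun n => if n == 0%N then c else 0).

Lemma coef_fpsCM c f n : (fpsC c * f) n = c * f n.
Proof.
rewrite coef_fpsM big_ord_recl /= subn0 big1 ?addr0// => i _.
by rewrite mul0r.
Qed.

Fact fpsC_is_zmod_morphism : zmod_morphism fpsC.
Proof.
by move=> a b; apply: fpsP => -[|n]; rewrite coef_fpsB//= subr0.
Qed.
HB.instance Definition _ :=
  GRing.isZmodMorphism.Build K fps fpsC fpsC_is_zmod_morphism.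

Fact fpsC_is_monoid_morphism : monoid_morphism fpsC.
Proof.
split=> [|a b]; first by apply: fpsP => -[|n].
by apply: fpsP => n; rewrite coef_fpsCM; case: n => //= n; rewrite mulr0.
Qed.
HB.instance Definition _ :=
  GRing.isMonoidMorphism.Build K fps fpsC fpsC_is_monoid_morphism.

(** The indeterminate [x]. *)
Definition fpsX := Fps (fun n => (n == 1%N)%:R).

Lemma coef_fpsXM f n : (fpsX * f) n = if n is n'.+1 then f n' else 0.
Proof.
case: n => [|n]; rewrite coef_fpsM; first by rewrite big_ord1 mul0r.
rewrite !big_ord_recl big1 /= => [|i _]; last by rewrite mul0r.
by rewrite addr0 mul0r add0r mul1r subn1.
Qed.

Lemma coef_fpsXnM m f n :
  (fpsX ^+ m * f) n = if (n < m)%N then 0 else f (n - m)%N.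
Proof.
elim: m n => [|m IH] n; first by rewrite mul1r ltn0 subn0.
by rewrite exprS -mulrA coef_fpsXM; case: n => // n; rewrite IH.
Qed.

Lemma fpsXn_inj m : injective (fun f => fpsX ^+ m * f).
Proof.
move=> f g /(congr1 fps_coef) e; apply: fpsP => n.
by move/(congr1 (@^~ (m + n)%N)): e; rewrite !coef_fpsXnM ltnNge leq_addr addKn.
Qed.

Lemma fps_factorXn m f : (forall i, (i < m)%N -> f i = 0) ->
  f = fpsX ^+ m * Fps (fun n => f (m + n)%N).
Proof.
move=> f0; apply: fpsP => n; rewrite coef_fpsXnM.
by case: ltnP => [/f0//|mn] /=; rewrite subnKC.
Qed.

Lemma coef_fpsM_low m f g : (forall i, (i < m)%N -> f i = 0) ->
  (f * g) m = f m * g 0%N.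
Proof.
move=> /fps_factorXn ->; rewrite -mulrA !coef_fpsXnM ltnn subnn.
by rewrite coef_fpsM0.
Qed.

(** A nonzero series is [x^m u] with [u(0) != 0]. *)
Lemma fps_order f : f != 0 ->
  exists m (u : fps), f = fpsX ^+ m * u /\ u 0%N != 0.
Proof.
move=> fN0; have ex : exists n, f n != 0.
  apply: contrapT => nex; move/eqP: fN0; apply; apply: fpsP => n.
  by apply/eqP/negP => /negP fn; apply: nex; exists n.
case: (ex_minnP ex) => m fm mmin.
exists m, (Fps (fun n => f (m + n)%N)); rewrite /= addn0; split=> //.
apply: fps_factorXn => i im; apply/eqP/negP => /negP /mmin.
by rewrite leqNgt im.
Qed.

Lemma fps_mulf_eq0 f g : f * g = 0 -> f != 0 -> g = 0.
Proof.
move=> fg0 /fps_order[m [u [fE u0]]]; apply/eqP/negP => /negP.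
move=> /fps_order[n [v [gE v0]]]; move: fg0; rewrite fE gE.
rewrite mulrACA -exprD => /(congr1 (fun f : fps => f (m + n)%N)).
rewrite coef_fpsXnM ltnn subnn coef_fpsM0 => /eqP.
by rewrite mulf_eq0 (negPf u0) (negPf v0).
Qed.

Lemma fps_mulfI f : f != 0 -> injective ( *%R f).
Proof.
move=> fN0 g h e; apply/eqP; rewrite -subr_eq0; apply/eqP.
by apply: fps_mulf_eq0 fN0; rewrite mulrBr e subrr.
Qed.

Lemma fps_neq0 f n : f n != 0 -> f != 0.
Proof. by apply: contra_neq => ->. Qed.

(** A system of equations [E y n = u n] is solved one coefficient after the
    other when the [n]-th equation involves only the coefficients of [y] up to
    [n], and involves the last one through a term [c * y n]. *)
Lemma fps_solve (E : fps -> nat -> K) (c : K) (u : nat -> K) : c != 0 ->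
  (forall (y z : fps) n, (forall i, (i < n)%N -> y i = z i) ->
     E y n - E z n = (y n - z n) * c) ->
  exists y : fps, forall n, E y n = u n.
Proof.
move=> c0 Eloc.
(* [Y n] has the right coefficients below [n], and [step n] sets the [n]-th. *)
pose step n (y : fps) := Fps (fun i =>
  if i == n then y n + (u n - E y n) / c else y i).
pose Y := fix Y n := if n is n'.+1 then step n' (Y n') else 0.
have YE i n : (i < n)%N -> Y n i = Y i.+1 i.
  elim: n => // n IH; rewrite ltnS leq_eqVlt => /predU1P[->//|lin].
  by rewrite -IH//=; case: eqP lin => // ->; rewrite ltnn.
exists (Fps (fun n => Y n.+1 n)) => n.
have := Eloc (Fps (fun n => Y n.+1 n)) (Y n) n (fun i lin => esym (YE i n lin)).
by rewrite /= eqxx (addrC (Y n n)) addrK divfK// => /addIr.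
Qed.

Lemma fps_unit f : f 0%N != 0 -> exists g : fps, f * g = 1.
Proof.
move=> f0.
have [|g gE] := @fps_solve (fun y n => (f * y) n) (f 0%N) (1 : fps) f0.
  move=> y z n yz; rewrite -coef_fpsB -mulrBr mulrC coef_fpsM_low// => i lin.
  by rewrite coef_fpsB yz// subrr.
by exists g; apply: fpsP.
Qed.

(** Existence of [m]-th roots. The root is sought as [1 + x y]: the
coefficient of [x^(n+1)] in [(1 + x y)^m] is [m y_n] plus an expression in
[y_0, ..., y_(n-1)], and [m] is invertible. *)
Lemma fps_root (K0 : [pchar K] =i pred0) m f : f 0%N = 1 -> (0 < m)%N ->
  exists w : fps, w 0%N = 1 /\ w ^+ m = f.
Proof.
move=> f0 m0; pose w (y : fps) : fps := 1 + fpsX * y.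
have w0 y : w y 0%N = 1 by rewrite coef_fpsD coef_fpsXM addr0.
have mN0 : m%:R != 0 :> K by move/pcharf0P: K0 => ->; rewrite -lt0n.
have [|y yE] := @fps_solve (fun y n => (w y ^+ m) n.+1) m%:R
    (fun n => f n.+1) mN0.
  move=> y z n yz.
  have -> : (w y ^+ m) n.+1 - (w z ^+ m) n.+1 = (w y ^+ m - w z ^+ m) n.+1 by [].
  rewrite subrXX.
  have -> : w y - w z = fpsX * (y - z) by rewrite /w; ring.
  rewrite -mulrA coef_fpsXM coef_fpsM_low => [|i lin]; last first.
    by rewrite coef_fpsB yz// subrr.
  rewrite coef_fps_sum (eq_bigr (fun=> 1)) => [|i _].
    by rewrite sumr_const card_ord.
  by rewrite coef_fpsM0 !coef_fpsX0 !w0 !expr1n mul1r.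
exists (w y); split; first exact: w0.
apply: fpsP => -[|n]; last exact: yE.
by rewrite coef_fpsX0 w0 expr1n.
Qed.

(** In [f^m - g^m = (f - g) \sum_i f^(m-1-i) g^i], the sum has constant term
[m f(0)^(m-1)], which does not vanish. *)
Lemma fps_expr_inj (K0 : [pchar K] =i pred0) m f g : (0 < m)%N ->
  f 0%N = g 0%N -> f 0%N != 0 -> f ^+ m = g ^+ m -> f = g.
Proof.
move=> m0 fg0 f0 /eqP; rewrite -subr_eq0 subrXX mulrC => /eqP /fps_mulf_eq0 h.
apply/eqP; rewrite -subr_eq0; apply/eqP/h/(@fps_neq0 _ 0%N).
rewrite coef_fps_sum (eq_bigr (fun=> f 0%N ^+ m.-1)) => [|i _].
  rewrite sumr_const card_ord -mulr_natl mulf_neq0 ?expf_neq0//.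
  by move/pcharf0P: K0 => ->; rewrite -lt0n.
rewrite coef_fpsM0 !coef_fpsX0 -fg0 -exprD; congr (_ ^+ _).
by have := ltn_ord i; lia.
Qed.

(** * Composition with a series without constant term *)

Section Composition.
Variable phi : fps.
Let F := fpsX * phi.

(** Composition [h(F)] with [F = X phi]; the powers [F ^+ j] with [j > n] do not
    contribute to the coefficient [n]. *)
Definition fps_comp h := Fps (fun n => \sum_(j < n.+1) h j * (F ^+ j) n).

Lemma coef_F_exp j n : (n < j)%N -> (F ^+ j) n = 0.
Proof. by move=> nj; rewrite exprMn coef_fpsXnM nj. Qed.

Lemma coef_comp_wide N h n : (n < N)%N ->
  fps_comp h n = (\sum_(j < N) fpsC (h j) * F ^+ j) n.
Proof.
move=> nN; rewrite coef_fps_sum [LHS]/=.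
rewrite (big_ord_widen N (fun j => h j * (F ^+ j) n))// big_mkcond.
apply: eq_bigr => j _; rewrite coef_fpsCM.
by case: ltnP => // nj; rewrite coef_F_exp// mulr0.
Qed.

(* On polynomials, composition with [F] is evaluation at [F]. *)
Let H (p : {poly K}) : fps := (map_poly fpsC p).[F].

Let coef_comp_poly N (p : {poly K}) h n : (forall i, (i < N)%N -> p`_i = h i) ->
  (n < N)%N -> fps_comp h n = H p n.
Proof.
move=> ph nN; set M := maxn (size p) N.
rewrite /H (@horner_coef_wide _ M); last by rewrite size_map_poly leq_maxl.
rewrite coef_fps_sum (@coef_comp_wide M); last by rewrite leq_max nN orbT.
rewrite coef_fps_sum; apply: eq_bigr => j _; rewrite coef_map !coef_fpsCM.
case: (ltnP j N) => [/ph -> //|Nj].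
by rewrite coef_F_exp ?mulr0//; lia.
Qed.

Fact fps_comp_is_zmod_morphism : zmod_morphism fps_comp.
Proof.
move=> f g; apply: fpsP => n; rewrite coef_fpsB /= -sumrB.
by apply: eq_bigr => j _; rewrite mulrBl.
Qed.
HB.instance Definition _ :=
  GRing.isZmodMorphism.Build fps fps fps_comp fps_comp_is_zmod_morphism.

Fact fps_comp_is_monoid_morphism : monoid_morphism fps_comp.
Proof.
split=> [|f g]; apply: fpsP => n.
  rewrite (@coef_comp_poly n.+1 1)// => [|i _]; last by rewrite coef1.
  by rewrite /H rmorph1 hornerC.
pose t := fps_trunc n.+1.
rewrite (@coef_comp_poly n.+1 (t f * t g)) => [|i il|//]; last first.
  by rewrite -fps_mul_trunc.
rewrite /H rmorphM hornerM !coef_fpsM; apply: eq_bigr => i _; congr (_ * _).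
  by rewrite (@coef_comp_poly n.+1 (t f))// => j; apply: coef_trunc.
rewrite (@coef_comp_poly n.+1 (t g)) ?ltnS ?leq_subr// => j.
exact: coef_trunc.
Qed.
HB.instance Definition _ :=
  GRing.isMonoidMorphism.Build fps fps fps_comp fps_comp_is_monoid_morphism.

Lemma fps_compM f g : fps_comp (f * g) = fps_comp f * fps_comp g.
Proof. exact: rmorphM. Qed.

Lemma fps_compXn f m : fps_comp (f ^+ m) = fps_comp f ^+ m.
Proof. exact: rmorphXn. Qed.

Lemma fps_compX : fps_comp fpsX = F.
Proof.
apply: fpsP => n; rewrite (@coef_comp_poly n.+2 'X)// => [|i _]; last first.
  by rewrite coefX.
by rewrite /H map_polyX hornerX.
Qed.

Lemma fps_compC c : fps_comp (fpsC c) = fpsC c.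
Proof.
apply: fpsP => n; rewrite (@coef_comp_poly n.+1 c%:P)// => [|i _]; last first.
  by rewrite coefC.
by rewrite /H map_polyC hornerC.
Qed.

Lemma coef_comp0 h : fps_comp h 0%N = h 0%N.
Proof. by rewrite /= big_ord1 coef_fps1 mulr1. Qed.

Lemma coef_comp1 h : fps_comp h 1%N = h 1%N * phi 0%N.
Proof.
rewrite /= !big_ord_recl big_ord0 coef_fps1 coef_fpsXM.
by rewrite mulr0 add0r addr0.
Qed.

End Composition.

End PowerSeriesRing.

(** * Riordan matrices acting on power series *)

Section Riordan.
Local Open Scope classical_set_scope.
Local Open Scope ring_scope.
Variable K : fieldType.
Local Notation fps := (fps K).
Local Notation X := (fpsX K).
Local Notation C := (@fpsC K).

Lemma series_expE (f : fps) j : series_exp f j = (f ^+ j : fps).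
Proof.
elim: j => // j IH; rewrite /series_exp iterS.
by rewrite -/(series_exp f j) IH exprS.
Qed.

Lemma riordan_mxE (g f : fps) i j : riordan_mx g f i j = (g * f ^+ j) i.
Proof. by rewrite /riordan_mx series_expE. Qed.

Lemma riordan_groupP (A : infmx K) : riordan_group K A <->
  exists g phi : fps,
    [/\ g 0%N != 0, phi 0%N != 0 & A = riordan_mx g (X * phi : fps)].
Proof.
split=> [[g [f [g0 f0 f1 ->]]]|[g [phi [g0 phi0 ->]]]].
  exists (Fps g), (Fps (fun n => f n.+1)); split=> //; congr riordan_mx.
  by apply/funext => n; rewrite coef_fpsXM; case: n.
by exists g, (X * phi : fps); split; rewrite ?coef_fpsXM.
Qed.

(** A Riordan matrix acts on column vectors by [h |-> g h(F)]. *)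
Lemma mulmxvec_riordan (g phi h : fps) :
  mulmxvec (riordan_mx g (X * phi : fps)) h = (g * fps_comp phi h : fps).
Proof.
apply/funext => i; rewrite /mulmxvec.
rewrite -(@fsbig_widen _ _ _ _ `I_i.+1)// => [|j [_ /negP ij]].
  rewrite -fsbig_ord coef_fpsM.
  transitivity ((g * \sum_(j < i.+1) C (h j) * (X * phi) ^+ j) i).
    rewrite mulr_sumr coef_fps_sum; apply: eq_bigr => j _.
    by rewrite riordan_mxE mulrCA coef_fpsCM mulrC.
  rewrite coef_fpsM; apply: eq_bigr => j _.
  by rewrite (@coef_comp_wide _ _ i.+1)// ltnS leq_subr.
rewrite -leqNgt in ij.
change (riordan_mx g (X * phi : fps) i j * h j = 0).
by rewrite riordan_mxE exprMn mulrCA coef_fpsXnM ij mul0r.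
Qed.

(** The eigenvector condition for [(g, x phi)] in terms of power series. *)
Definition riordan_eigen (g phi h : fps) :=
  h != 0 /\ exists lambda : K, g * fps_comp phi h = C lambda * h.

Lemma eigenvector_riordan (g phi h : fps) :
  eigenvector (riordan_mx g (X * phi : fps)) h <-> riordan_eigen g phi h.
Proof.
rewrite /eigenvector mulmxvec_riordan; split=> -[hN0 [l e]]; split.
- by apply/eqP => h0; apply: hN0; rewrite h0.
- by exists l; apply: fpsP => n; rewrite e coef_fpsCM.
- by move=> h0; move/eqP: hN0; apply; apply: fpsP => n; rewrite h0.
- by exists l; apply/funext => n; rewrite e coef_fpsCM.
Qed.

Lemma has_levelP k (h : fps) :
  has_level k h <-> exists2 v : fps, v 0%N != 0 & h = X ^+ k * v.
Proof.
split=> [[h0 hk]|[v v0 ->]].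
  exists (Fps (fun n => h (k + n)%N)); first by rewrite /= addn0.
  exact: fps_factorXn.
split=> [i ik|]; rewrite coef_fpsXnM; first by rewrite ik.
by rewrite ltnn subnn.
Qed.

Lemma has_level_inj k l (h : vec K) : has_level k h -> has_level l h -> k = l.
Proof.
move=> [h0 hk] [h0' hl]; case: (ltngtP k l) => // [/h0'|/h0] /eqP.
  by rewrite (negPf hk).
by rewrite (negPf hl).
Qed.

Lemma has_level_scale k c (h : vec K) : c != 0 ->
  has_level k h -> has_level k (fun i => c * h i).
Proof.
move=> c0 [h0 hk]; split=> [i /h0 ->|]; first by rewrite mulr0.
exact: mulf_neq0.
Qed.

(** * Eigenvectors of a Riordan matrix *)

Section Eigenvectors.
Variables g phi : fps.
Hypotheses (g0 : g 0%N != 0) (phi0 : phi 0%N != 0).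
Local Notation T := (fps_comp phi).
Local Notation A := (riordan_mx g (X * phi : fps)).

Let compXn k (v : fps) : T (X ^+ k * v) = X ^+ k * (phi ^+ k * T v).
Proof. by rewrite fps_compM fps_compXn fps_compX exprMn mulrA. Qed.

(** The eigenvalue of an eigenvector of level [k] is the [k]-th diagonal entry
    of the matrix. *)
Lemma eigenvalue_level k (v : fps) lambda : v 0%N != 0 ->
  g * T (X ^+ k * v) = C lambda * (X ^+ k * v) ->
  g * phi ^+ k * T v = C lambda * v /\ lambda = g 0%N * phi 0%N ^+ k.
Proof.
move=> v0; rewrite compXn mulrCA (mulrCA (C _)) => /fpsXn_inj e.
rewrite -mulrA; split=> //; move/(congr1 (fun f : fps => f 0%N)): e.
rewrite coef_fpsCM !coef_fpsM0 coef_fpsX0 coef_comp0 mulrA => e.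
exact/esym/(mulIf v0).
Qed.

(** Two eigenvectors of different levels yield a series [p = x w] with
[p(F) = F'(0) p] and an eigenvector [e] of level [0]. *)
Lemma linearized_of_eigen2 (K0 : [pchar K] =i pred0) k l (v v' : fps)
    (lambda mu : K) : (k < l)%N -> v 0%N != 0 -> v' 0%N != 0 ->
  g * T (X ^+ k * v) = C lambda * (X ^+ k * v) ->
  g * T (X ^+ l * v') = C mu * (X ^+ l * v') ->
  exists w e : fps, [/\ w 0%N != 0, e 0%N != 0,
    T (X * w) = C (phi 0%N) * (X * w) & g * T e = C (g 0%N) * e].
Proof.
move=> kl v0 v'0 hv hv'.
have [_ lamE] := eigenvalue_level v0 hv.
have [_ muE] := eigenvalue_level v'0 hv'.
have lam0 : lambda != 0 by rewrite lamE mulf_neq0// expf_neq0.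
pose m := (l - k)%N; have m0 : (0 < m)%N by rewrite subn_gt0.
have lE : l = (m + k)%N by rewrite subnK// ltnW.
have muE' : mu = lambda * phi 0%N ^+ m.
  by rewrite muE lamE lE exprD; ring.
have [vi vvi] := fps_unit v0.
have vi0 : vi 0%N != 0.
  move/(congr1 (fun f : fps => f 0%N)): vvi; rewrite coef_fpsM0 coef_fps1.
  by apply: contra_eq_neq => ->; rewrite mulr0 eq_sym oner_eq0.
(* [c] normalizes the quotient [v' / v], so that it has an [m]-th root. *)
pose c := v' 0%N * vi 0%N; have c0 : c != 0 by rewrite mulf_neq0.
have [|w [w0 wE]] := fps_root K0 (f := C c^-1 * (v' * vi)) _ m0.
  by rewrite coef_fpsCM coef_fpsM0 mulVf.
have CcV : C c * C c^-1 = 1 by rewrite -rmorphM mulfV// rmorph1.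
have h'E : X ^+ l * v' = C c * (X * w) ^+ m * (X ^+ k * v).
  rewrite exprMn wE lE exprD.
  transitivity (C c * C c^-1 * (v * vi) * (X ^+ m * X ^+ k * v')).
    by rewrite CcV vvi !mul1r.
  by ring.
have hN0 : X ^+ k * v != 0.
  by apply: (@fps_neq0 _ _ k); rewrite coef_fpsXnM ltnn subnn.
have Tp : T (X * w) ^+ m = (C (phi 0%N) * (X * w)) ^+ m.
  have dN0 : C (c * lambda) * (X ^+ k * v) != 0.
    apply: (@fps_neq0 _ _ k); rewrite coef_fpsCM coef_fpsXnM ltnn subnn.
    by rewrite !mulf_neq0.
  apply: (fps_mulfI dN0); move: hv'; rewrite h'E !fps_compM fps_compC fps_compXn.
  rewrite !fps_compM => e.
  transitivity (C c * (T X * T w) ^+ m * (g * T (X ^+ k * v))).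
    by rewrite hv !rmorphM; ring.
  transitivity (g * (C c * (T X * T w) ^+ m * (T (X ^+ k) * T v))).
    by rewrite fps_compM; ring.
  by rewrite e muE' !rmorphM rmorphXn !exprMn; ring.
have Tw : phi * T w = C (phi 0%N) * w.
  apply: (fps_expr_inj K0 m0).
  - by rewrite coef_fpsM0 coef_fpsCM coef_comp0.
  - by rewrite coef_fpsM0 coef_comp0 w0 mulr1.
  - apply: (@fpsXn_inj _ m); rewrite -!exprMn.
    by rewrite mulrA -fps_compX -fps_compM Tp; congr (_ ^+ _); ring.
have TXw : T (X * w) = C (phi 0%N) * (X * w).
  by rewrite fps_compM fps_compX -mulrA Tw; ring.
have wN0 : w 0%N != 0 by rewrite w0 oner_neq0.
have [wi wwi] := fps_unit wN0.
have wi0 : wi 0%N = 1.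
  move/(congr1 (fun f : fps => f 0%N)): wwi.
  by rewrite coef_fpsM0 coef_fps1 w0 mul1r.
exists w, (wi ^+ k * v); split=> //.
  by rewrite coef_fpsM0 coef_fpsX0 wi0 expr1n mul1r.
have hE : X ^+ k * v = (X * w) ^+ k * (wi ^+ k * v).
  transitivity ((w * wi) ^+ k * (X ^+ k * v)); first by rewrite wwi expr1n mul1r.
  by rewrite !exprMn; ring.
have dN0 : C (phi 0%N) ^+ k * (X * w) ^+ k != 0.
  rewrite -rmorphXn exprMn; apply: (@fps_neq0 _ _ k).
  rewrite coef_fpsCM coef_fpsXnM ltnn subnn coef_fpsX0 w0 expr1n mulr1.
  by rewrite expf_neq0.
apply: (fps_mulfI dN0); move: hv; rewrite hE fps_compM fps_compXn TXw lamE.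
rewrite exprMn [C (_ * _)]rmorphM /= [C (_ ^+ _)]rmorphXn /= => e.
transitivity (g * (C (phi 0%N) ^+ k * (X * w) ^+ k * T (wi ^+ k * v))).
  by ring.
by rewrite e; ring.
Qed.

Lemma riordan_in_group : riordan_group K A.
Proof. by apply/riordan_groupP; exists g, phi. Qed.

(** If [p = x w] satisfies [p(F) = F'(0) p] and [e] is an eigenvector of level
[0], then [p^k e] is an eigenvector of level [k]. *)
Lemma riordan_full_of_linearized (w e : fps) : w 0%N != 0 -> e 0%N != 0 ->
  T (X * w) = C (phi 0%N) * (X * w) -> g * T e = C (g 0%N) * e ->
  riordan_full K A.
Proof.
move=> w0 e0 TXw Te; split; first exact: riordan_in_group.
exists (fun k => X ^+ k * (w ^+ k * e) : fps) => k.
have lev : has_level k (X ^+ k * (w ^+ k * e) : fps).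
  apply/has_levelP; exists (w ^+ k * e) => //.
  by rewrite coef_fpsM0 coef_fpsX0 mulf_neq0 ?expf_neq0.
split=> //; apply/eigenvector_riordan; split.
  by case: lev => _; apply: fps_neq0.
exists (g 0%N * phi 0%N ^+ k).
have -> : X ^+ k * (w ^+ k * e) = (X * w) ^+ k * e by rewrite exprMn mulrA.
rewrite fps_compM fps_compXn TXw mulrCA Te [(C _ * _) ^+ k]exprMn.
by rewrite [C (_ * _)]rmorphM /= [C (_ ^+ _)]rmorphXn /=; ring.
Qed.

Lemma riordan_full_of_levels (K0 : [pchar K] =i pred0) k l (h h' : fps) :
  (k < l)%N -> has_level k h -> has_level l h' ->
  eigenvector A h -> eigenvector A h' -> riordan_full K A.
Proof.
move=> kl /has_levelP[v v0 ->] /has_levelP[v' v'0 ->].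
move=> /eigenvector_riordan[_ [lam hv]] /eigenvector_riordan[_ [mu hv']].
have [w [e [w0 e0 Tw Te]]] := linearized_of_eigen2 K0 kl v0 v'0 hv hv'.
exact: (riordan_full_of_linearized w0 e0 Tw Te).
Qed.

(** Two eigenvectors of the same level have the same eigenvalue, so either they
    are proportional or a combination of them is an eigenvector of higher
    level. *)
Lemma eigenvector_same_level k (h h' : fps) :
  has_level k h -> has_level k h' -> eigenvector A h -> eigenvector A h' ->
  (exists2 c, c != 0 & h' = C c * h) \/
  (exists l (d : fps), [/\ (k < l)%N, has_level l d & eigenvector A d]).
Proof.
move=> lh lh'; case: (lh) (lh') => h0 hk [h'0 h'k].
move=> /eigenvector_riordan[_ [lam hv]] /eigenvector_riordan[_ [mu hv']].
have lm : lam = mu.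
  move/has_levelP: lh hv => [v v0 ->] /(eigenvalue_level v0)[_ ->].
  by move/has_levelP: lh' hv' => [v' v'0 ->] /(eigenvalue_level v'0)[_ ->].
pose c := h' k / h k; have c0 : c != 0 by rewrite mulf_neq0 ?invr_neq0.
pose d := h' - C c * h; have [d0|dN0] := eqVneq d 0.
  by left; exists c => //; apply/eqP; rewrite -subr_eq0 -/d d0.
right; have [l [u [dE u0]]] := fps_order dN0.
have ld : has_level l d by apply/has_levelP; exists u.
exists l, d; split=> //.
  rewrite ltnNge; apply/negP => lk; case: ld => _ /eqP; apply.
  rewrite coef_fpsB coef_fpsCM; move: lk; rewrite leq_eqVlt => /predU1P[->|lk].
    by rewrite divfK// subrr.
  by rewrite h0// h'0// mulr0 subrr.
apply/eigenvector_riordan; split=> //; exists mu.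
rewrite raddfB /= fps_compM fps_compC mulrBr hv' mulrCA hv lm /d /=.
by ring.
Qed.

Lemma eigenvector_scale c (h : fps) : c != 0 -> eigenvector A h ->
  eigenvector A (C c * h : fps).
Proof.
move=> c0 /eigenvector_riordan[hN0 [lam hv]]; apply/eigenvector_riordan; split.
  apply/eqP => /fps_mulf_eq0 Cc; move/eqP: hN0; apply; apply: Cc.
  by rewrite fmorph_eq0.
exists lam; rewrite fps_compM fps_compC mulrCA hv /=; ring.
Qed.

Lemma riordan_level_or_full (K0 : [pchar K] =i pred0) k (h : fps) :
  has_level k h -> eigenvector A h -> riordan_level K k A \/ riordan_full K A.
Proof.
move=> lh eh; have [full|nfull] := pselect (riordan_full K A); first by right.
left; split; first exact: riordan_in_group.
exists h => //; apply/seteqP; split=> [v0 ev|_ [c c0 ->]]; last first.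
  have -> : (fun i => c * h i) = (C c * h : fps).
    by apply/funext => i; rewrite coef_fpsCM.
  exact: eigenvector_scale.
rewrite /=; have [v vE] : exists v : fps, v0 = v by exists (Fps v0).
rewrite {v0}vE in ev *.
have /eigenvector_riordan[vN0 _] := ev.
have [l [u [vE u0]]] := fps_order vN0.
have lv : has_level l v by apply/has_levelP; exists u.
case: (ltngtP k l) => kl.
- by case: nfull; exact: (riordan_full_of_levels K0 kl lh lv eh ev).
- by case: nfull; exact: (riordan_full_of_levels K0 kl lv lh ev eh).
rewrite -kl in lv.
have [[c c0 ->]|[j [d [kj ld ed]]]] := eigenvector_same_level lh lv eh ev.
  by exists c => //; apply/funext => i; rewrite coef_fpsCM.
by case: nfull; exact: (riordan_full_of_levels K0 kj lh ld eh ed).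
Qed.

(** When the diagonal is constant equal to [1], an eigenvector of level [l]
    forces the subdiagonal entry of column [l] to vanish. *)
Lemma eigenvector_unipotent_level l (h : fps) :
  g 0%N = 1 -> phi 0%N = 1 -> has_level l h -> eigenvector A h ->
  g 1%N + phi 1%N *+ l = 0.
Proof.
move=> g1 phi1 /has_levelP[v v0 ->] /eigenvector_riordan[_ [lam hv]].
have [e lamE] := eigenvalue_level v0 hv.
have lam1 : lam = 1 by rewrite lamE g1 phi1 expr1n mulr1.
move/(congr1 (fun f : fps => f 1%N)): e.
rewrite coef_fpsCM lam1 mul1r !coef_fpsM1 coef_fpsM0 coef_fpsX0 coef_fpsX1//.
rewrite coef_comp1 coef_comp0 g1 phi1 expr1n !mul1r mulr1 => e.
apply: (mulIf v0); rewrite mul0r; apply: (addrI (v 1%N)).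
by rewrite addr0 -[RHS]e; ring.
Qed.

End Eigenvectors.

(** * Examples in each class *)

Lemma riordan_full_id : riordan_full K (riordan_mx (1 : fps) (X * 1 : fps)).
Proof.
have oneE : (1 : fps) 0%N = 1 by [].
have one0 : (1 : fps) 0%N != 0 by rewrite oneE oner_neq0.
apply: (@riordan_full_of_linearized _ _ _ _ 1 1) => //.
  by rewrite oneE mulr1 fps_compX mulr1 rmorph1 mul1r.
by rewrite oneE !rmorph1.
Qed.

(** The matrix [(1 + x, x)]. *)
Lemma riordan_none_shift : riordan_none K (riordan_mx (1 + X : fps) (X * 1 : fps)).
Proof.
have one0 : (1 : fps) 0%N = 1 by [].
have g0 : (1 + X) 0%N = 1 by rewrite coef_fpsD addr0.
split=> [|h eh]; first by apply: riordan_in_group; rewrite ?g0 ?oner_neq0.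
have {}eh : eigenvector (riordan_mx (1 + X : fps) (X * 1 : fps)) (Fps h) by [].
have [hN0 _] := iffLR (eigenvector_riordan _ _ _) eh.
have [l [u [hE u0]]] := fps_order hN0.
have lh : has_level l (Fps h) by apply/has_levelP; exists u.
have := eigenvector_unipotent_level g0 one0 lh eh.
rewrite coef_fpsD !coef_fps1 /= mul0rn add0r addr0 => /eqP.
by rewrite oner_eq0.
Qed.

(** The matrix [((1 - x)^k, x / (1 - x))] fixes [x^k]. *)
Lemma riordan_level_nonempty (K0 : [pchar K] =i pred0) k :
  exists A, riordan_level K k A.
Proof.
have o0 : (1 - X) 0%N = 1 by rewrite coef_fpsB subr0.
have o1 : (1 - X) 1%N = -1 by rewrite coef_fpsB sub0r.
have oN0 : (1 - X) 0%N != 0 by rewrite o0 oner_neq0.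
have [Y YE] := fps_unit oN0.
have Y0 : Y 0%N = 1.
  by move/(congr1 (fun f : fps => f 0%N)): YE; rewrite coef_fpsM0 o0 mul1r.
have Y1 : Y 1%N = 1.
  move/(congr1 (fun f : fps => f 1%N)): YE; rewrite coef_fpsM1 o0 o1 Y0 coef_fps1.
  by rewrite mul1r mulr1 => /eqP; rewrite subr_eq0 => /eqP.
have g0 : ((1 - X) ^+ k) 0%N = 1 by rewrite coef_fpsX0 o0 expr1n.
have gN0 : ((1 - X) ^+ k) 0%N != 0 by rewrite g0 oner_neq0.
have YN0 : Y 0%N != 0 by rewrite Y0 oner_neq0.
(* [Y = 1 / (1 - x)] *)
exists (riordan_mx ((1 - X) ^+ k : fps) (X * Y : fps)).
have lX j : has_level j (X ^+ j : fps).
  by apply/has_levelP; exists 1; rewrite ?mulr1// coef_fps1 oner_neq0.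
have eX :
    eigenvector (riordan_mx ((1 - X) ^+ k : fps) (X * Y : fps)) (X ^+ k : fps).
  apply/eigenvector_riordan; split.
    by case: (lX k) => _; apply: fps_neq0.
  exists 1; rewrite fps_compXn fps_compX -exprMn rmorph1 mul1r; congr (_ ^+ _).
  by rewrite mulrCA YE mulr1.
have [//|[_ [h /(_ k.+1)[eh lh]]]] := riordan_level_or_full gN0 YN0 K0 (lX k) eX.
(* A full set would contain an eigenvector of level [k + 1]. *)
have := @eigenvector_unipotent_level _ _ k.+1 (Fps (h k.+1)) g0 Y0 lh eh.
rewrite coef_fpsX1// o1 Y1 mulrS mulNrn addrCA addNr addr0 => /eqP.
by rewrite oner_eq0.
Qed.

(** * The partition *)

Lemma riordan_full_level_disjoint k (A : infmx K) :
  riordan_full K A -> riordan_level K k A -> False.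
Proof.
move=> [_ [h hP]] [_ [v lv evE]].
suff lev j : j = k by have := lev k.+1; lia.
have [+ lj] := hP j; rewrite evE => -[c c0 hE].
by apply: (has_level_inj lj); rewrite hE; apply: has_level_scale.
Qed.

Lemma riordan_level_inj k l (A : infmx K) :
  riordan_level K k A -> riordan_level K l A -> k = l.
Proof.
move=> [_ [h lh ehE]] [_ [v lv evE]].
have : eigenvector A h.
  by rewrite ehE; exists 1; rewrite ?oner_neq0//; apply/funext => i; rewrite mul1r.
rewrite evE => -[c c0 hE].
by apply: (has_level_inj lh); rewrite hE; apply: has_level_scale.
Qed.

Lemma riordan_level_eigenvector k (A : infmx K) :
  riordan_level K k A -> exists h, eigenvector A h.
Proof.
move=> [_ [h lh ehE]]; exists h; rewrite ehE; exists 1; first exact: oner_neq0.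
by apply/funext => i; rewrite mul1r.
Qed.

(** The partition holds over every field of characteristic zero. *)
Theorem riordan_partition (K0 : [pchar K] =i pred0) :
  partition [set: eigentype] (eigenclass K) (riordan_group K).
Proof.
split.
- apply/seteqP; split=> [A [[|k|] _ []]//|A RA].
  have [[h eh]|neh] := pselect (exists h, eigenvector A h); last first.
    by exists EigenNone => //; split=> // h eh; apply: neh; exists h.
  have [g [phi [g0 phi0 AE]]] := iffLR (riordan_groupP A) RA.
  rewrite {A RA}AE in eh *.
  have {}eh : eigenvector (riordan_mx g (X * phi : fps)) (Fps h) by [].
  have [hN0 _] := iffLR (eigenvector_riordan _ _ _) eh.
  have [k [u [hE u0]]] := fps_order hN0.
  have lh : has_level k (Fps h) by apply/has_levelP; exists u.
  by have [] := riordan_level_or_full g0 phi0 K0 lh eh;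
    [exists (EigenLevel k)|exists EigenFull].
- move=> s t _ _ [A []]; case: s t => [|k|] [|l|] //=.
  + by move=> /riordan_full_level_disjoint h /h.
  + by move=> [_ [h /(_ 0%N)[eh _]]] [_ /(_ _ eh)].
  + by move=> + /riordan_full_level_disjoint h => /h.
  + by move=> lk ll; rewrite (riordan_level_inj lk ll).
  + by move=> /riordan_level_eigenvector[h eh] [_ /(_ _ eh)].
  + by move=> [_ nA] [_ [h /(_ 0%N)[/nA]]].
  + by move=> [_ nA] /riordan_level_eigenvector[h /nA].
- move=> [|k|] _ /=.
  + by exists (riordan_mx (1 : fps) (X * 1 : fps)); exact: riordan_full_id.
  + exact: riordan_level_nonempty.
  + by exists (riordan_mx (1 + X : fps) (X * 1 : fps)); exact: riordan_none_shift.
Qed.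

End Riordan.

Local Open Scope classical_set_scope.

Theorem theorem3p13 (R : realType) :
  partition [set: eigentype] (eigenclass R) (riordan_group R) /\
  partition [set: eigentype] (eigenclass R[i]) (riordan_group R[i]).
Proof. by split; apply: riordan_partition; exact: pchar_num. Qed.
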